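(* Let $\Sigma$ and $\Omega$ be finite sets. For all regular expressions $e,f$ over the alphabet $\Sigma+T_{\mathrm{BA}}$, if $\mathcal{H}_{\mathrm{kabo}}^\star(\llbracket e\rrbracket)=\mathcal{H}_{\mathrm{kabo}}^\star(\llbracket f\rrbracket)$ then $\mathsf{KA}_{\mathcal{H}_{\mathrm{kabo}}}\vdash e=f$.
   Context: Regular expressions over an alphabet $X$: $e,f::=e+f\mid e\cdot f\mid e^*\mid 0\mid 1\mid a$ ($a\in X$), with usual language $\llbracket e\rrbracket$. Kleene algebra axioms: idempotent semiring axioms plus $1+xx^*\le x^*$, $x+yz\le z\Rightarrow y^*x\le z$, $x+yz\le y\Rightarrow xz^*\le y$. A hypothesis is a pair $e\le f$; an equation as hypothesis stands for two inequations. $\mathsf{KA}_H\vdash e=f$ means derivable in equational logic from all instances of the Kleene algebra axioms and the hypotheses in $H$, letters being constants (no substitution rule). The $H$-closure $H^\star(L)$ is the smallest language containing $L$ such that for all $e\le f\in H$ and words $u,v$, $u\llbracket f\rrbracket v\subseteq H^\star(L)$ implies $u\llbracket e\rrbracket v\subseteq H^\star(L)$. $T_{\mathrm{BA}}$ is the set of Boolean expressions over $\Omega$ (connectives $\vee,\wedge,\neg,\bot,\top$), each a single letter of $\Sigma+T_{\mathrm{BA}}$. $\mathcal{H}_{\mathrm{bool}}$ is the set of all instances of Boolean algebra axioms. $\mathcal{H}_{\mathrm{kao}}=\mathcal{H}_{\mathrm{bool}}\cup\{\phi\wedge\psi\le\phi\cdot\psi,\ \phi\vee\psi=\phi+\psi\mid\phi,\psi\in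 T_{\mathrm{BA}}\}\cup\{\bot=0\}$, and $\mathcal{H}_{\mathrm{kabo}}=\mathcal{H}_{\mathrm{kao}}\cup\{\top=1\}$. *)

(* Defs.v *)
From mathcomp Require Import all_boot.
From mathcomp Require Import classical_sets.

Set Implicit Arguments.
Unset Strict Implicit.
Unset Printing Implicit Defensive.

Local Open Scope classical_set_scope.

Declare Scope regexp_scope.
Delimit Scope regexp_scope with RE.

Inductive regexp (A : Type) : Type :=
| RZero
| ROne
| RLetter of A
| RPlus of regexp A & regexp A
| RDot of regexp A & regexp A
| RStar of regexp A.

Arguments RZero {A}.
Arguments ROne {A}.
Bind Scope regexp_scope with regexp.

Notation "0" := RZero : regexp_scope.
Notation "1" := ROne : regexp_scope.
Notation "e + f" := (RPlus e f) : regexp_scope.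
Notation "e * f" := (RDot e f) : regexp_scope.
Notation "e ^*" := (RStar e) : regexp_scope.

Section Languages.
Variable A : Type.

Definition lang_cat (K L : set (seq A)) : set (seq A) :=
  [set w | exists u v, [/\ K u, L v & w = u ++ v]].

Fixpoint lang_exp (L : set (seq A)) (n : nat) : set (seq A) :=
  if n is n'.+1 then lang_cat L (lang_exp L n') else [set [::]].

Fixpoint lang (e : regexp A) : set (seq A) :=
  match e with
  | RZero => set0
  | ROne => [set [::]]
  | RLetter a => [set [:: a]]
  | RPlus e1 e2 => lang e1 `|` lang e2
  | RDot e1 e2 => lang_cat (lang e1) (lang e2)
  | RStar e1 => \bigcup_n lang_exp (lang e1) n
  end.

End Languages.

(* A pair (e, f) stands for the hypothesis e <= f. *)
Definition hypotheses (A : Type) : Type := set (regexp A * regexp A).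

Definition hyp_eq (A : Type) (e f : regexp A) : hypotheses A :=
  [set (e, f)] `|` [set (f, e)].

Section Closure.
Variables (A : Type) (H : hypotheses A).

Definition H_closed (L : set (seq A)) : Prop :=
  forall e f : regexp A, H (e, f) -> forall u v : seq A,
    [set u ++ w ++ v | w in lang f] `<=` L ->
    [set u ++ w ++ v | w in lang e] `<=` L.

Definition H_closure (L : set (seq A)) : set (seq A) := smallest H_closed L.

End Closure.

Section Derivability.
Variables (A : Type) (H : hypotheses A).
Local Open Scope regexp_scope.

(* An inequation e <= f abbreviates e + f = f. There is no substitution rule:
   H is an arbitrary set of pairs of closed terms, used as they are. *)
Inductive KA_derivable : regexp A -> regexp A -> Prop :=
| KA_refl e : KA_derivable e e
| KA_sym e f : KA_derivable e f -> KA_derivable f e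
| KA_trans e f g : KA_derivable e f -> KA_derivable f g -> KA_derivable e g
| KA_plus_cong e e' f f' :
    KA_derivable e e' -> KA_derivable f f' -> KA_derivable (e + f) (e' + f')
| KA_dot_cong e e' f f' :
    KA_derivable e e' -> KA_derivable f f' -> KA_derivable (e * f) (e' * f')
| KA_star_cong e e' : KA_derivable e e' -> KA_derivable e^* e'^*
| KA_plusA x y z : KA_derivable (x + (y + z)) ((x + y) + z)
| KA_plusC x y : KA_derivable (x + y) (y + x)
| KA_plus0 x : KA_derivable (x + 0) x
| KA_plus_idem x : KA_derivable (x + x) x
| KA_dotA x y z : KA_derivable (x * (y * z)) ((x * y) * z)
| KA_1dot x : KA_derivable (1 * x) x
| KA_dot1 x : KA_derivable (x * 1) x
| KA_0dot x : KA_derivable (0 * x) 0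
| KA_dot0 x : KA_derivable (x * 0) 0
| KA_dotDl x y z : KA_derivable ((x + y) * z) (x * z + y * z)
| KA_dotDr x y z : KA_derivable (x * (y + z)) (x * y + x * z)
| KA_star_unfold x : KA_derivable ((1 + x * x^*) + x^*) x^*
| KA_star_indl x y z :
    KA_derivable ((x + y * z) + z) z -> KA_derivable (y^* * x + z) z
| KA_star_indr x y z :
    KA_derivable ((x + y * z) + y) y -> KA_derivable (x * z^* + y) y
| KA_hyp e f : H (e, f) -> KA_derivable (e + f) f.

End Derivability.

Inductive bexp (Omega : Type) : Type :=
| BVar of Omega
| BOr of bexp Omega & bexp Omega
| BAnd of bexp Omega & bexp Omega
| BNeg of bexp Omega
| BBot
| BTop.

Arguments BBot {Omega}.
Arguments BTop {Omega}.

Inductive ba_axiom (Omega : Type) : bexp Omega -> bexp Omega -> Prop :=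
| BA_orA p q r : ba_axiom (BOr p (BOr q r)) (BOr (BOr p q) r)
| BA_andA p q r : ba_axiom (BAnd p (BAnd q r)) (BAnd (BAnd p q) r)
| BA_orC p q : ba_axiom (BOr p q) (BOr q p)
| BA_andC p q : ba_axiom (BAnd p q) (BAnd q p)
| BA_orK p q : ba_axiom (BOr p (BAnd p q)) p
| BA_andK p q : ba_axiom (BAnd p (BOr p q)) p
| BA_orDr p q r :
    ba_axiom (BOr p (BAnd q r)) (BAnd (BOr p q) (BOr p r))
| BA_andDr p q r :
    ba_axiom (BAnd p (BOr q r)) (BOr (BAnd p q) (BAnd p r))
| BA_or_bot p : ba_axiom (BOr p BBot) p
| BA_and_top p : ba_axiom (BAnd p BTop) p
| BA_or_neg p : ba_axiom (BOr p (BNeg p)) BTop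
| BA_and_neg p : ba_axiom (BAnd p (BNeg p)) BBot.

(* Axiom instances are taken at any subexpression. A Boolean expression is a
   single letter of the regular expressions, so KA_derivable supplies
   reflexivity, symmetry and transitivity between Boolean expressions but no
   congruence for the Boolean connectives. With instances at the root only, the
   hypotheses would depend on the chosen axiomatisation of Boolean algebra. *)
Inductive ba_instance (Omega : Type) : bexp Omega -> bexp Omega -> Prop :=
| BAi_axiom p q : ba_axiom p q -> ba_instance p q
| BAi_orl p p' q : ba_instance p p' -> ba_instance (BOr p q) (BOr p' q)
| BAi_orr p q q' : ba_instance q q' -> ba_instance (BOr p q) (BOr p q')
| BAi_andl p p' q : ba_instance p p' -> ba_instance (BAnd p q) (BAnd p' q)
| BAi_andr p q q' : ba_instance q q' -> ba_instance (BAnd p q) (BAnd p q')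
| BAi_neg p p' : ba_instance p p' -> ba_instance (BNeg p) (BNeg p').

Section BooleanHypotheses.
Variables Sigma Omega : Type.
Local Notation letters := (Sigma + bexp Omega)%type.

Definition test (p : bexp Omega) : regexp letters := RLetter (inr p).

Definition hyp_bool : hypotheses letters :=
  [set h | exists p q, ba_instance p q /\ hyp_eq (test p) (test q) h].

Definition hyp_kao : hypotheses letters :=
  hyp_bool
  `|` [set h | exists p q, h = (test (BAnd p q), (test p * test q)%RE)]
  `|` [set h | exists p q, hyp_eq (test (BOr p q)) (test p + test q)%RE h]
  `|` hyp_eq (test BBot) 0%RE.

Definition hyp_kabo : hypotheses letters :=
  hyp_kao `|` hyp_eq (test BTop) 1%RE.

End BooleanHypotheses.

Arguments hyp_bool : clear implicits.
Arguments hyp_kao : clear implicits.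
Arguments hyp_kabo : clear implicits.

(* Main.v *)
(* Call a subset of Omega an atom and read it as its minterm; write t for the sum
   of all atoms. The hypotheses prove t = 1, a <= 1 and a <= a a for each atom a,
   and that every test is the sum of the atoms below it. Hence e = t e' t, where e'
   arises from e by replacing each test by the sum of its atoms and each letter x
   of Sigma by t x t. In a word v of t e' t every position is next to an atom, and
   for such words the H-closure of the language of f has a simple description: v
   belongs to it exactly if some word of f arises from v by replacing each atom a
   by a sequence of tests above a.

   This property is recognised by the subset automaton of the partial derivatives
   of f. Let S i j be the expression for its paths from i to j. For each expression
   r, r is below the sum of the S i j over those j that some word of r reaches from
   i, by induction on r. As the automaton is deterministic, if it accepts all words
   of r then all these j are accepting. If j is accepting, S i j is below
   z_i for any solution z of the inequations a z_(i.a) <= z_i and 1 <= z_j; the sums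
   of partial derivatives form one, whose value at the initial state is f. *)

Require Import Defs.
From mathcomp Require Import all_boot.
From mathcomp Require Import boolp classical_sets.
From Stdlib Require Import Setoid Morphisms Relations.
From Stdlib Require List.

Set Implicit Arguments.
Unset Strict Implicit.
Unset Printing Implicit Defensive.

Local Open Scope regexp_scope.

(* An inductive type rather than a definition, so that [rewrite] does not unfold
   an inequation to an equation. *)
Variant KA_le (A : Type) (H : hypotheses A) (e f : regexp A) : Prop :=
| KA_leI of KA_derivable H (e + f) f.

(** * Order reasoning in Kleene algebra under hypotheses *)

Section KleeneAlgebra.
Variables (A : Type) (H : hypotheses A).
Local Notation "e === f" := (KA_derivable H e f) (at level 70).
Local Notation "e <== f" := (KA_le H e f) (at level 70).
Implicit Types e f g x y z : regexp A.

#[local] Hint Resolve KA_refl : core.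

#[global] Instance KA_derivable_equivalence : Equivalence (KA_derivable H).
Proof.
split; [exact: KA_refl | by move=> ? ?; exact: KA_sym |].
by move=> e f g; exact: KA_trans.
Qed.

#[global] Instance RPlus_derivable_proper :
  Proper (KA_derivable H ==> KA_derivable H ==> KA_derivable H) (@RPlus A).
Proof. by move=> ? ? ? ? ? ?; exact: KA_plus_cong. Qed.

#[global] Instance RDot_derivable_proper :
  Proper (KA_derivable H ==> KA_derivable H ==> KA_derivable H) (@RDot A).
Proof. by move=> ? ? ? ? ? ?; exact: KA_dot_cong. Qed.

Lemma KA_leE e f : e <== f <-> e + f === f.
Proof. by split=> [[]|/KA_leI]. Qed.

#[global] Instance KA_le_derivable_proper :
  Proper (KA_derivable H ==> KA_derivable H ==> iff) (KA_le H).
Proof. by move=> e e' ee' f f' ff'; rewrite !KA_leE ee' ff'. Qed.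

#[global] Instance KA_le_preorder : PreOrder (KA_le H).
Proof.
split=> [e | e f g]; rewrite !KA_leE; first exact: KA_plus_idem.
move=> ef fg; apply: KA_trans (KA_plus_cong (KA_refl H e) (KA_sym fg)) _.
by rewrite KA_plusA ef; exact: fg.
Qed.

#[global] Instance KA_le_rewrite : RewriteRelation (KA_le H) := {}.

Lemma KA_le_refl e : e <== e. Proof. by reflexivity. Qed.
#[local] Hint Resolve KA_le_refl : core.

Lemma KA_le_trans f e g : e <== f -> f <== g -> e <== g.
Proof. by move=> ef fg; transitivity f. Qed.

Lemma KA_le_antisym e f : e <== f -> f <== e -> e === f.
Proof. by rewrite !KA_leE => ef fe; rewrite -{1}fe KA_plusC. Qed.

Lemma KA_le0 e : 0 <== e.
Proof. by rewrite KA_leE KA_plusC KA_plus0. Qed.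

Lemma KA_le_plusl e f : e <== e + f.
Proof. by rewrite KA_leE KA_plusA KA_plus_idem. Qed.

Lemma KA_le_plusr e f : f <== e + f.
Proof. by rewrite KA_plusC; exact: KA_le_plusl. Qed.

Lemma KA_plus_le e f g : e <== g -> f <== g -> e + f <== g.
Proof. by rewrite !KA_leE => eg fg; rewrite -KA_plusA fg. Qed.

#[global] Instance RPlus_le_proper :
  Proper (KA_le H ++> KA_le H ++> KA_le H) (@RPlus A).
Proof.
move=> e e' ee' f f' ff'; apply: KA_plus_le.
  by rewrite ee'; exact: KA_le_plusl.
by rewrite ff'; exact: KA_le_plusr.
Qed.

#[global] Instance RDot_le_proper :
  Proper (KA_le H ++> KA_le H ++> KA_le H) (@RDot A).
Proof.
move=> e e' /KA_leE ee' f f' /KA_leE ff'; transitivity (e * f').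
  by rewrite KA_leE -KA_dotDr ff'.
by rewrite KA_leE -KA_dotDl ee'.
Qed.

Lemma KA_star_ge1 e : 1 <== e^*.
Proof.
rewrite -[X in _ <== X]KA_star_unfold.
by apply: KA_le_trans (KA_le_plusl _ _); exact: KA_le_plusl.
Qed.

Lemma KA_star_ge_dot e : e * e^* <== e^*.
Proof.
rewrite -[X in _ <== X]KA_star_unfold.
by apply: KA_le_trans (KA_le_plusl _ _); exact: KA_le_plusr.
Qed.

Lemma KA_star_ind_left e f g : f <== g -> e * g <== g -> e^* * f <== g.
Proof. by move=> fg eg; apply/KA_leE/KA_star_indl/KA_leE; exact: KA_plus_le. Qed.

Lemma KA_star_ind_right e f g : f <== g -> g * e <== g -> f * e^* <== g.
Proof. by move=> fg eg; apply/KA_leE/KA_star_indr/KA_leE; exact: KA_plus_le. Qed.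

#[global] Instance RStar_le_proper : Proper (KA_le H ++> KA_le H) (@RStar A).
Proof.
move=> e f ef; rewrite -[e^*]KA_dot1.
apply: KA_star_ind_left; first exact: KA_star_ge1.
by rewrite ef; exact: KA_star_ge_dot.
Qed.

Lemma KA_star_dot_star e : e^* * e^* <== e^*.
Proof. by apply: KA_star_ind_left; [reflexivity | exact: KA_star_ge_dot]. Qed.

Lemma KA_star_ge e : e <== e^*.
Proof.
by rewrite -{1}[e]KA_dot1 (KA_star_ge1 e); exact: KA_star_ge_dot.
Qed.

Lemma KA_le_bigplus (I : finType) (P : pred I) (F : I -> regexp A) i :
  P i -> F i <== \big[@RPlus A/0]_(j | P j) F j.
Proof.
move=> Pi; move: (mem_index_enum i); elim: (index_enum I) => //= j s IHs.
rewrite inE big_cons => /predU1P[<-|/IHs le_i].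
  by rewrite Pi; exact: KA_le_plusl.
by case: (P j) => //; rewrite le_i; exact: KA_le_plusr.
Qed.

Lemma KA_bigplus_le (I : finType) (P : pred I) (F : I -> regexp A) e :
  (forall i, P i -> F i <== e) -> \big[@RPlus A/0]_(i | P i) F i <== e.
Proof.
move=> le_e; apply: (big_ind (fun x => x <== e)) => //; first exact: KA_le0.
by move=> x y; exact: KA_plus_le.
Qed.

Lemma KA_bigplus_dot_le (I : finType) (P : pred I) (F : I -> regexp A) e f :
  (forall i, P i -> F i * e <== f) -> (\big[@RPlus A/0]_(i | P i) F i) * e <== f.
Proof.
move=> le_f; apply: (big_ind (fun x => x * e <== f)) => //.
  by rewrite KA_0dot; exact: KA_le0.
by move=> x y xf yf; rewrite KA_dotDl; exact: KA_plus_le.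
Qed.

Lemma KA_dot_bigplus_le (I : finType) (P : pred I) (F : I -> regexp A) e f :
  (forall i, P i -> e * F i <== f) -> e * (\big[@RPlus A/0]_(i | P i) F i) <== f.
Proof.
move=> le_f; apply: (big_ind (fun x => e * x <== f)) => //.
  by rewrite KA_dot0; exact: KA_le0.
by move=> x y xf yf; rewrite KA_dotDr; exact: KA_plus_le.
Qed.

End KleeneAlgebra.

(** * The star of a finite matrix of expressions *)

Section MatrixStar.
Variables (A : Type) (H : hypotheses A) (Q : finType).
#[local] Hint Resolve KA_refl KA_le_refl : core.
Variable M : Q -> Q -> regexp A.
Local Notation "e <== f" := (KA_le H e f) (at level 70).

(* [elim_paths s i j] denotes the nonempty paths from [i] to [j] whose
   intermediate states lie in [s] (McNaughton-Yamada). *)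
Fixpoint elim_paths (s : seq Q) (i j : Q) : regexp A :=
  if s is k :: s' then
    elim_paths s' i j
    + elim_paths s' i k * ((elim_paths s' k k)^* * elim_paths s' k j)
  else M i j.

Definition matrix_star (i j : Q) : regexp A :=
  (if i == j then 1 else 0) + elim_paths (enum Q) i j.

Lemma elim_paths_ge s i j : M i j <== elim_paths s i j.
Proof.
elim: s => [|k s IHs] /=; first exact: KA_le_refl.
by rewrite IHs; exact: KA_le_plusl.
Qed.

(** The last segment of a path through [k] turns [z j] into [z k], star induction absorbs the loops
    at [k], and the first segment leads to [z i]. *)
Lemma elim_paths_ind (z : Q -> regexp A) :
  (forall i j, M i j * z j <== z i) ->
  forall s i j, elim_paths s i j * z j <== z i.
Proof.
move=> Mz; elim=> [|k s IHs] i j //=.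
rewrite KA_dotDl; apply: KA_plus_le => //.
rewrite -!KA_dotA IHs (KA_star_ind_left (KA_le_refl _ _) (IHs k k)).
exact: IHs.
Qed.

(** Induction on [s], with [l] the state eliminated last. If [k] is [l], the loops at [l] absorb
    what either factor contributes there, as [Rs * Rs <= Rs]; otherwise the induction hypothesis
    joins the inner segments at [k]. *)
Lemma elim_paths_trans s i k j : k \in s ->
  elim_paths s i k * elim_paths s k j <== elim_paths s i j.
Proof.
elim: s i k j => //= l s IHs i k j.
set R := elim_paths s; set Rs := (R l l)^*.
have RsRs : Rs * Rs <== Rs by exact: KA_star_dot_star.
have RRs : R l l * Rs <== Rs by exact: KA_star_ge_dot.
have ltop : R i l * (Rs * R l j) <== R i j + R i l * (Rs * R l j).
  exact: KA_le_plusr.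
rewrite inE => /predU1P[->|ks].
  have Rr : R i l + R i l * (Rs * R l l) <== R i l * Rs.
    apply: KA_plus_le.
      by rewrite -{1}[R i l]KA_dot1 (KA_star_ge1 H (R l l)); reflexivity.
    by rewrite (KA_star_ge H (R l l)) -/Rs RsRs; reflexivity.
  have Rl : R l j + R l l * (Rs * R l j) <== Rs * R l j.
    apply: KA_plus_le.
      by rewrite -{1}[R l j]KA_1dot (KA_star_ge1 H (R l l)); reflexivity.
    by rewrite KA_dotA RRs; reflexivity.
  by rewrite Rr Rl -KA_dotA (KA_dotA _ Rs Rs) RsRs.
have IH i' j' : R i' k * R k j' <== R i' j' by exact: IHs.
rewrite KA_dotDl !KA_dotDr -!KA_dotA; do !apply: KA_plus_le.
- by rewrite IH; exact: KA_le_plusl.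
- by rewrite KA_dotA IH.
- by rewrite IH.
- rewrite (KA_dotA _ (R l k)) IH (KA_dotA _ (R l l)) RRs.
  by rewrite (KA_dotA _ Rs Rs) RsRs.
Qed.

Lemma matrix_star_ge1 i : 1 <== matrix_star i i.
Proof. by rewrite /matrix_star eqxx; exact: KA_le_plusl. Qed.

Lemma matrix_star_ge i j : M i j <== matrix_star i j.
Proof. by rewrite (elim_paths_ge (enum Q)); exact: KA_le_plusr. Qed.

Lemma matrix_star_trans i k j :
  matrix_star i k * matrix_star k j <== matrix_star i j.
Proof.
rewrite /matrix_star KA_dotDl; apply: KA_plus_le.
  case: (eqVneq i k) => [->|_]; first by rewrite KA_1dot; reflexivity.
  by rewrite KA_0dot; exact: KA_le0.
rewrite KA_dotDr; apply: KA_plus_le.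
  case: (eqVneq k j) => [->|_]; first by rewrite KA_dot1; exact: KA_le_plusr.
  by rewrite KA_dot0; exact: KA_le0.
by rewrite elim_paths_trans ?mem_enum //; exact: KA_le_plusr.
Qed.

Lemma matrix_star_ind (z : Q -> regexp A) :
  (forall i j, M i j * z j <== z i) ->
  forall i j, matrix_star i j * z j <== z i.
Proof.
move=> Mz i j; rewrite /matrix_star KA_dotDl.
apply: KA_plus_le; last exact: elim_paths_ind.
case: (eqVneq i j) => [->|_]; first by rewrite KA_1dot; reflexivity.
by rewrite KA_0dot; exact: KA_le0.
Qed.

End MatrixStar.

(** * Substitution for letters, and deterministic automata *)

Fixpoint rsubst (A B : Type) (iota : B -> regexp A) (r : regexp B) : regexp A :=
  match r with
  | RZero => 0
  | ROne => 1
  | RLetter b => iota b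
  | RPlus r1 r2 => rsubst iota r1 + rsubst iota r2
  | RDot r1 r2 => rsubst iota r1 * rsubst iota r2
  | RStar r1 => (rsubst iota r1)^*
  end.

Lemma lang_star_ind (A : Type) (e : regexp A) (P : seq A -> Prop) :
  P [::] -> (forall u v, lang e u -> P v -> P (u ++ v)) ->
  forall w, lang e^* w -> P w.
Proof.
move=> P0 Pcat w [n _]; elim: n w => [|n IHn] w /=; first by move=> ->.
by move=> [u [v [eu /IHn Pv ->]]]; exact: Pcat.
Qed.

Lemma lang_star_nil (A : Type) (e : regexp A) : lang e^* [::].
Proof. by exists 0%N. Qed.

Lemma lang_star_cat (A : Type) (e : regexp A) u v :
  lang e u -> lang e^* v -> lang e^* (u ++ v).
Proof. by move=> eu [n _ env]; exists n.+1 => //; exists u, v. Qed.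

Lemma lang_star_catr (A : Type) (e : regexp A) u v :
  lang e^* u -> lang e v -> lang e^* (u ++ v).
Proof.
move=> eu ev; elim/lang_star_ind: eu => [|u1 u2 eu1 eu2].
  by rewrite -[v]cats0 cat0s; apply: lang_star_cat => //; exact: lang_star_nil.
by rewrite -catA; exact: lang_star_cat.
Qed.

Section Automaton.
Variables (A : Type) (B Q : finType) (H : hypotheses A).
Variables (iota : B -> regexp A) (delta : Q -> B -> Q).
Local Notation "e <== f" := (KA_le H e f) (at level 70).
#[local] Hint Resolve KA_refl KA_le_refl : core.

Definition transition_matrix (i j : Q) : regexp A :=
  \big[@RPlus A/0]_(b | delta i b == j) iota b.

Local Notation S := (matrix_star transition_matrix).

(** A classical truth value, so that the property can index a finite sum. *)
Definition reachable (r : regexp B) (i j : Q) : bool :=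
  `[< exists2 v, lang r v & foldl delta i v = j >].

Lemma rsubst_le_reachable (r : regexp B) (i : Q) :
  rsubst iota r <== \big[@RPlus A/0]_(j | reachable r i j) S i j.
Proof.
elim: r i => [||b|r IHr r' IHr'|r IHr r' IHr'|r IHr] i /=.
- exact: KA_le0.
- rewrite (matrix_star_ge1 H transition_matrix i).
  by apply: (KA_le_bigplus H (S i)); apply/asboolP; exists [::].
- transitivity (S i (delta i b)).
    by rewrite -matrix_star_ge; apply: KA_le_bigplus.
  by apply: (KA_le_bigplus H (S i)); apply/asboolP; exists [:: b].
- by rewrite (IHr i) (IHr' i); apply: KA_plus_le; apply: KA_bigplus_le => j;
    move=> /asboolP[v rv vj]; apply: (KA_le_bigplus H (S i)); apply/asboolP;
    exists v => //; [left|right].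
- rewrite (IHr i); apply: KA_bigplus_dot_le => k /asboolP[u ru uk].
  rewrite (IHr' k); apply: KA_dot_bigplus_le => j /asboolP[v rv vj].
  rewrite matrix_star_trans; apply: (KA_le_bigplus H (S i)); apply/asboolP.
  by exists (u ++ v); [exists u, v | rewrite foldl_cat uk].
(* Right induction keeps the initial state [i] fixed: the sum of the [S i j] absorbs one more factor
   [r] on its right. *)
- rewrite -[_^*](KA_1dot H); apply: KA_star_ind_right.
    rewrite (matrix_star_ge1 H transition_matrix i).
    apply: (KA_le_bigplus H (S i)); apply/asboolP; exists [::] => //.
    exact: lang_star_nil.
  apply: KA_bigplus_dot_le => k /asboolP[u ru uk].
  rewrite (IHr k); apply: KA_dot_bigplus_le => j /asboolP[v rv vj].
  rewrite matrix_star_trans; apply: (KA_le_bigplus H (S i)); apply/asboolP.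
  by exists (u ++ v); [exact: lang_star_catr | rewrite foldl_cat uk].
Qed.

(** Every [j] reached by a word of [r] has [1 <= z j], so [S i j <= S i j * z j], and this is below
    [z i] because [z] is a solution. *)
Lemma rsubst_le_solution (z : Q -> regexp A) (r : regexp B) (i : Q) :
  (forall q b, iota b * z (delta q b) <== z q) ->
  (forall v, lang r v -> 1 <== z (foldl delta i v)) ->
  rsubst iota r <== z i.
Proof.
move=> zdelta zfin; rewrite (rsubst_le_reachable r i).
apply: KA_bigplus_le => j /asboolP[v /zfin + vj]; rewrite vj => z1.
rewrite -[S i j](KA_dot1 H) z1; apply: matrix_star_ind => p q.
by apply: KA_bigplus_dot_le => b /eqP <-.
Qed.

End Automaton.

(** * Partial derivatives and their finiteness *)

Section PartialDerivatives.
Variables (A : Type) (H : hypotheses A).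
Local Notation "e <== f" := (KA_le H e f) (at level 70).
#[local] Hint Resolve KA_refl KA_le_refl : core.
Implicit Types e f g : regexp A.

Fixpoint nullable e : bool :=
  match e with
  | RZero | RLetter _ => false
  | ROne | RStar _ => true
  | RPlus e1 e2 => nullable e1 || nullable e2
  | RDot e1 e2 => nullable e1 && nullable e2
  end.

(* Antimirov's partial derivatives, as a relation: letters need no decidable
   equality. *)
Fixpoint pderiv e (a : A) g : Prop :=
  match e with
  | RZero | ROne => False
  | RLetter b => a = b /\ g = 1
  | RPlus e1 e2 => pderiv e1 a g \/ pderiv e2 a g
  | RDot e1 e2 => (exists2 g1, pderiv e1 a g1 & g = g1 * e2)
                  \/ nullable e1 /\ pderiv e2 a g
  | RStar e1 => exists2 g1, pderiv e1 a g1 & g = g1 * e1^*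
  end.

Fixpoint pderivs e (w : seq A) g : Prop :=
  if w is a :: w' then exists2 e', pderiv e a e' & pderivs e' w' g else g = e.

(** Bounds the iterated partial derivatives up to syntactic equality, with no quotient of
    expressions; the list may be larger than the set of these derivatives. *)
Fixpoint pderiv_closure e : seq (regexp A) :=
  match e with
  | RZero => [:: 0]
  | ROne => [:: 1]
  | RLetter _ => [:: e; 1]
  | RPlus e1 e2 => e :: pderiv_closure e1 ++ pderiv_closure e2
  | RDot e1 e2 => [seq g * e2 | g <- pderiv_closure e1] ++ pderiv_closure e2
  | RStar e1 => e :: [seq g * e1^* | g <- pderiv_closure e1]
  end.

Fixpoint word_regexp (w : seq A) : regexp A :=
  if w is a :: w' then RLetter a * word_regexp w' else 1.

Lemma nullable_ge1 e : nullable e -> 1 <== e.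
Proof.
elim: e => //= [e IHe f IHf|e IHe f IHf|e _ _].
- case/orP=> [/IHe->|/IHf->]; [exact: KA_le_plusl | exact: KA_le_plusr].
- by case/andP=> /IHe <- /IHf <-; rewrite KA_1dot.
- exact: KA_star_ge1.
Qed.

Lemma pderiv_le e a g : pderiv e a g -> RLetter a * g <== e.
Proof.
elim: e g => //= [b|e IHe f IHf|e IHe f IHf|e IHe] g.
- by move=> [-> ->]; rewrite KA_dot1.
- by case=> [/IHe->|/IHf->]; [exact: KA_le_plusl | exact: KA_le_plusr].
- case=> [[e' /IHe ee' ->]|[/nullable_ge1 e1 /IHf ->]].
    by rewrite KA_dotA ee'.
  by rewrite -e1 KA_1dot.
- by move=> [e' /IHe ee' ->]; rewrite KA_dotA ee'; exact: KA_star_ge_dot.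
Qed.

Lemma pderivs_le e w g : pderivs e w g -> word_regexp w * g <== e.
Proof.
elim: w e => [|a w IHw] e /=; first by move=> ->; rewrite KA_1dot.
by move=> [e' /pderiv_le <- /IHw <-]; rewrite KA_dotA.
Qed.

Lemma lang_nullable e : lang e [::] -> nullable e.
Proof.
elim: e => //= [e IHe f IHf|e IHe f IHf].
- by case=> [/IHe->|/IHf->] //; rewrite orbT.
- by move=> [[|? ?] [[|? ?] [eu fv]]] //= _; rewrite IHe ?IHf.
Qed.

Lemma lang_pderiv e a w :
  lang e (a :: w) -> exists2 g, pderiv e a g & lang g w.
Proof.
elim: e w => [||b|e IHe f IHf|e IHe f IHf|e IHe] w //=.
- by case=> -> ->; exists 1.
- by case=> [/IHe|/IHf] [g eg gw]; exists g => //; [left|right].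
- move=> [[|a' u] [v [eu fv]]] /=.
    move=> fv'; move: fv; rewrite -fv' => /IHf[g fg gw].
    by exists g => //; right; split=> //; exact: lang_nullable.
  case=> aa' ->; move: eu; rewrite -aa' => /IHe[g eg gu].
  by exists (g * f); [left; exists g | exists u, v].
(* Induction on [n] skips the empty factors in front; the first nonempty one begins with [a]. *)
- move=> [n _]; elim: n => [//|n IHn] /= [[|a' u] [v [eu ev]]] /=.
    by move=> ve; move: ev; rewrite -ve.
  case=> aa' ->; move: eu; rewrite -aa' => /IHe[g eg gu].
  by exists (g * e^*); [exists g | exists u, v; split=> //; exists n].
Qed.

Lemma lang_pderivs e u w :
  lang e (u ++ w) -> exists2 g, pderivs e u g & lang g w.
Proof.
elim: u e => [|a u IHu] e /=; first by exists e.
by move=> /lang_pderiv[e' ee' /IHu[g e'g gw]]; exists g => //; exists e'.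
Qed.

Lemma pderiv_closure_refl e : List.In e (pderiv_closure e).
Proof.
elim: e => /=; try by left.
move=> e IHe f _; apply/List.in_app_iff; left.
by apply/List.in_map_iff; exists e.
Qed.

Lemma pderiv_closure_step e a g g' :
  List.In g (pderiv_closure e) -> pderiv g a g' -> List.In g' (pderiv_closure e).
Proof.
elim: e g g' => [||b|e IHe f IHf|e IHe f IHf|e IHe] g g' /=.
- by case=> // <-.
- by case=> // <-.
- by case=> [|[]] // <- //= [_ ->]; right; left.
- case=> [<- /=|]; rewrite !List.in_app_iff.
    by case=> h; right; [left; apply: (IHe e)|right; apply: (IHf f)];
      rewrite //; exact: pderiv_closure_refl.
  by case=> [/IHe h /h|/IHf h /h]; auto.
- rewrite !List.in_app_iff !List.in_map_iff.
  case=> [[e1 [<- e1e]] /= |/IHf h /h]; last by right.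
  case=> [[e2 e12 ->]|[_ h]].
    by left; exists e2; split=> //; exact: IHe e12.
  by right; apply: IHf h; exact: pderiv_closure_refl.
- rewrite !List.in_map_iff => -[<- /= [e1 ee1 ->]|].
    right; exists e1; split=> //; apply: IHe ee1; exact: pderiv_closure_refl.
  case=> [e1 [<- e1e]] /= [[e2 e12 ->]|[_ [e2 ee2 ->]]]; right; exists e2.
    by split=> //; exact: IHe e12.
  by split=> //; apply: IHe ee2; exact: pderiv_closure_refl.
Qed.

Lemma pderiv_closure_steps e w g g' :
  List.In g (pderiv_closure e) -> pderivs g w g' ->
  List.In g' (pderiv_closure e).
Proof.
elim: w g => [|a w IHw] g ge /=; first by move=> ->.
by move=> [g1 /(pderiv_closure_step ge) /IHw]; apply.
Qed.

(** Expressions over [A] need not have decidable equality, so the states are positions in the list;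
    one expression may occupy several. *)
Lemma pderiv_closure_enum e : exists (n : nat) (state : 'I_n -> regexp A),
  forall g, List.In g (pderiv_closure e) <-> exists i, state i = g.
Proof.
exists (size (pderiv_closure e)), (fun i => nth 0 (pderiv_closure e) i) => g.
elim: (pderiv_closure e) => [|x s IHs] /=; first by split=> // -[[]].
split=> [[->|/IHs[i <-]]|[[[|i] lti] /= gE]].
- by exists ord0.
- by exists (lift ord0 i); rewrite lift0.
- by left.
- by right; apply: IHs.2; exists (Ordinal (lti : i < size s)%N).
Qed.

End PartialDerivatives.

(** * Inclusion through the subset automaton of partial derivatives *)

Section BlockInclusion.
Variables (A : Type) (B : finType) (H : hypotheses A).
Variables (iota : B -> regexp A) (block : B -> set (seq A)).
Local Notation "e <== f" := (KA_le H e f) (at level 70).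
#[local] Hint Resolve KA_refl KA_le_refl : core.

Fixpoint blocks (v : seq B) : set (seq A) :=
  if v is b :: v' then lang_cat (block b) (blocks v') else [set [::]]%classic.

Hypothesis iota_le_block :
  forall b s, block b s -> iota b <== word_regexp s.

(* With [RLetter] for [iota] and the singleton of [[:: b]] for [block b] this is
   Kozen's completeness theorem. *)
Theorem rsubst_le_of_blocks (r : regexp B) (f : regexp A) :
  (forall v, lang r v -> exists2 u, lang f u & blocks v u) ->
  rsubst iota r <== f.
Proof.
move=> rf; have [n [state stateP]] := pderiv_closure_enum f.
(* Subset construction in which reading [b] means reading any word of [block b], a language that may
   be infinite. *)
pose delta (T : {set 'I_n}) b :=
  [set j | `[< exists i s, [/\ i \in T, block b s & pderivs (state i) s (state j)] >]].
pose z (T : {set 'I_n}) := \big[@RPlus A/0]_(i in T) state i.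
(* The matching word [u] is followed block by block to a nullable derivative, whose index lies in
   the final subset. *)
have accept v (T : {set 'I_n}) i u : i \in T -> lang (state i) u -> blocks v u ->
    1 <== z (foldl delta T v).
  elim: v T i u => [|b v IHv] T i u iT iu /=.
    move=> u0; rewrite u0 in iu.
    rewrite (nullable_ge1 H (lang_nullable iu)).
    exact: (KA_le_bigplus H state).
  move=> [s [u' [bs vu' uE]]]; move: iu; rewrite uE => /lang_pderivs[g ig gu'].
  have cl_i : List.In (state i) (pderiv_closure f) by apply/stateP; exists i.
  have [j jE] := (stateP g).1 (pderiv_closure_steps cl_i ig).
  apply: (IHv _ j u') => //; last by rewrite jE.
  by rewrite inE; apply/asboolP; exists i, s; split=> //; rewrite jE.
have [i0 i0E] := (stateP f).1 (pderiv_closure_refl f).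
transitivity (z [set i0]); last first.
  by apply: KA_bigplus_le => i; rewrite inE => /eqP->; rewrite i0E.
apply: (rsubst_le_solution (delta := delta) (z := z)) => [T b|v /rf[u fu vu]].
  (* [z] is a solution: [iota b] is below the word [s] of its block, and [s] times a derivative
     along [s] is below the expression derived. *)
  apply: KA_dot_bigplus_le => j; rewrite inE => /asboolP[i [s [iT bs ij]]].
  rewrite (iota_le_block bs) (pderivs_le H ij); exact: (KA_le_bigplus H state).
by apply: (accept _ _ i0) vu; rewrite ?inE ?i0E.
Qed.

End BlockInclusion.

(** * Provable Boolean equality and minterms *)

Section BooleanAlgebra.
Variable Omega : finType.
Implicit Types (p q : bexp Omega) (a : {set Omega}) (s : seq Omega).

(** Here rewriting under the connectives is possible, whereas [KA_derivable] sees a Boolean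
    expression as one letter; [test_proper] carries the results over. *)
Definition ba_eq : relation (bexp Omega) := clos_refl_sym_trans _ (@ba_instance Omega).

#[global] Instance ba_eq_equivalence : Equivalence ba_eq.
Proof.
split=> [p|p q|p q r]; [exact: rst_refl | exact: rst_sym | exact: rst_trans].
Qed.

Lemma ba_axiom_eq p q : ba_axiom p q -> ba_eq p q.
Proof. by move=> pq; apply/rst_step/BAi_axiom. Qed.

Lemma ba_eq_congr (F : bexp Omega -> bexp Omega) :
  (forall p q, ba_instance p q -> ba_instance (F p) (F q)) ->
  forall p q, ba_eq p q -> ba_eq (F p) (F q).
Proof.
move=> Finst p q; elim=> {p q} [p q /Finst|p|p q _|p q r _ pq _ qr].
- exact: rst_step.
- exact: rst_refl.
- exact: rst_sym.
- exact: rst_trans pq qr.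
Qed.

#[global] Instance BOr_ba_proper :
  Proper (ba_eq ==> ba_eq ==> ba_eq) (@BOr Omega).
Proof.
move=> p p' pp' q q' qq'; transitivity (BOr p' q).
  apply: (ba_eq_congr (F := fun r => BOr r q)) => // ? ?; exact: BAi_orl.
apply: (ba_eq_congr (F := BOr p')) => // ? ?; exact: BAi_orr.
Qed.

#[global] Instance BAnd_ba_proper :
  Proper (ba_eq ==> ba_eq ==> ba_eq) (@BAnd Omega).
Proof.
move=> p p' pp' q q' qq'; transitivity (BAnd p' q).
  apply: (ba_eq_congr (F := fun r => BAnd r q)) => // ? ?; exact: BAi_andl.
apply: (ba_eq_congr (F := BAnd p')) => // ? ?; exact: BAi_andr.
Qed.

#[global] Instance BNeg_ba_proper : Proper (ba_eq ==> ba_eq) (@BNeg Omega).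
Proof. by apply: ba_eq_congr => p q; exact: BAi_neg. Qed.

#[local] Hint Extern 0 (ba_eq _ _) => reflexivity : core.

Lemma BAndA p q r : ba_eq (BAnd p (BAnd q r)) (BAnd (BAnd p q) r).
Proof. exact/ba_axiom_eq/BA_andA. Qed.
Lemma BAndC p q : ba_eq (BAnd p q) (BAnd q p).
Proof. exact/ba_axiom_eq/BA_andC. Qed.
Lemma BAndDr p q r : ba_eq (BAnd p (BOr q r)) (BOr (BAnd p q) (BAnd p r)).
Proof. exact/ba_axiom_eq/BA_andDr. Qed.
Lemma BAnd_top p : ba_eq (BAnd p BTop) p.
Proof. exact/ba_axiom_eq/BA_and_top. Qed.
Lemma BOr_bot p : ba_eq (BOr p BBot) p.
Proof. exact/ba_axiom_eq/BA_or_bot. Qed.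
Lemma BOrC p q : ba_eq (BOr p q) (BOr q p).
Proof. exact/ba_axiom_eq/BA_orC. Qed.
Lemma BOr_neg p : ba_eq (BOr p (BNeg p)) BTop.
Proof. exact/ba_axiom_eq/BA_or_neg. Qed.
Lemma BAnd_neg p : ba_eq (BAnd p (BNeg p)) BBot.
Proof. exact/ba_axiom_eq/BA_and_neg. Qed.

Lemma BAnd_idem p : ba_eq (BAnd p p) p.
Proof.
by rewrite -[BAnd p p]BOr_bot -(BAnd_neg p) -BAndDr BOr_neg BAnd_top.
Qed.

Lemma BAnd_bot p : ba_eq (BAnd p BBot) BBot.
Proof. by rewrite -{1}(BAnd_neg p) BAndA BAnd_idem BAnd_neg. Qed.

Lemma BOr_idem p : ba_eq (BOr p p) p.
Proof.
by rewrite -{2}(BAnd_idem p); exact/ba_axiom_eq/BA_orK.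
Qed.

(* A set of variables stands for the valuation making exactly these true. *)
Fixpoint sat a p : bool :=
  match p with
  | BVar x => x \in a
  | BOr q r => sat a q || sat a r
  | BAnd q r => sat a q && sat a r
  | BNeg q => ~~ sat a q
  | BBot => false
  | BTop => true
  end.

Lemma ba_instance_sat a p q : ba_instance p q -> sat a p = sat a q.
Proof.
elim=> {p q} [p q []|p p' q _|p q q' _|p p' q _|p q q' _|p p' _] /=;
  try by move=> ->.
all: by move=> *; repeat match goal with
  | |- context [sat ?b ?x] => is_var x; case: (sat b x) end.
Qed.

Definition literal a x : bexp Omega := if x \in a then BVar x else BNeg (BVar x).

Definition minterm_on a s : bexp Omega :=
  foldr (fun x p => BAnd (literal a x) p) BTop s.

Definition minterm a : bexp Omega := minterm_on a (enum Omega).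

Lemma minterm_on_var a s x : x \in s ->
  ba_eq (BAnd (minterm_on a s) (literal a x)) (minterm_on a s).
Proof.
elim: s => //= y s IHs; rewrite inE => /predU1P[->|/IHs IH].
  by rewrite BAndC BAndA BAnd_idem.
by rewrite -BAndA IH.
Qed.

(** A minterm decides every formula. Stating both outcomes at once lets the induction pass through
    negation. *)
Lemma minterm_and a p :
  ba_eq (BAnd (minterm a) p) (if sat a p then minterm a else BBot).
Proof.
have bot_and q : ba_eq (BAnd BBot q) BBot by rewrite BAndC BAnd_bot.
elim: p => [x|p IHp q IHq|p IHp q IHq|p IHp||] /=.
- have := minterm_on_var a (mem_enum Omega x); rewrite -/(minterm a) /literal.
  case: (x \in a) => [//|] lit.
  by rewrite -lit -BAndA [BAnd (BNeg _) _]BAndC BAnd_neg BAnd_bot.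
- rewrite BAndDr IHp IHq; case: (sat a p) (sat a q) => -[] //=.
  + by rewrite BOr_idem.
  + by rewrite BOr_bot.
  + by rewrite BOrC BOr_bot.
  + by rewrite BOr_bot.
- rewrite BAndA IHp; case: (sat a p) => //=; exact: IHq.
- case: (sat a p) IHp => /= IHp.
    by rewrite -IHp -BAndA BAnd_neg BAnd_bot.
  (* The meet with [p] is [BBot], so it can be added to complete the disjunction of [p] and its
     negation. *)
  by rewrite -[BAnd _ (BNeg p)]BOr_bot -IHp -BAndDr BOrC BOr_neg BAnd_top.
- exact: BAnd_bot.
- exact: BAnd_top.
Qed.

End BooleanAlgebra.

(** * Tests under the hypotheses, and their decomposition into atoms *)

Section Tests.
Variables (Sigma Omega : finType).
Local Notation letter := (Sigma + bexp Omega)%type.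
Local Notation Hk := (hyp_kabo Sigma Omega).
Local Notation test := (@test Sigma Omega).
Local Notation "e === f" := (KA_derivable Hk e f) (at level 70).
Local Notation "e <== f" := (KA_le Hk e f) (at level 70).
#[local] Hint Resolve KA_refl KA_le_refl : core.
Implicit Types (p q : bexp Omega) (a : {set Omega}).

Lemma KA_le_hyp e f : Hk (e, f) -> e <== f.
Proof. by move=> ef; rewrite KA_leE; exact: KA_hyp. Qed.

#[global] Instance test_proper : Proper (@ba_eq Omega ==> KA_derivable Hk) test.
Proof.
move=> p q; elim=> {p q} [p q pq|p|p q _ pq|p q r _ pq _ qr] //.
- by apply: KA_le_antisym; apply: KA_le_hyp; left; left; left; left; exists p, q;
    split=> //; [left | right].
- by symmetry.
- by rewrite pq.
Qed.

Lemma test_or p q : test (BOr p q) === test p + test q.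
Proof.
by apply: KA_le_antisym; apply: KA_le_hyp; left; left; right; exists p, q;
  [left | right].
Qed.

Lemma test_bot : test BBot === 0.
Proof. by apply: KA_le_antisym; apply: KA_le_hyp; left; right; [left|right]. Qed.

Lemma test_top : test BTop === 1.
Proof. by apply: KA_le_antisym; apply: KA_le_hyp; right; [left|right]. Qed.

Lemma test_and_le p q : test (BAnd p q) <== test p * test q.
Proof. by apply: KA_le_hyp; left; left; left; right; exists p, q. Qed.

Lemma test_le1 p : test p <== 1.
Proof. by rewrite -test_top -(BOr_neg p) test_or; exact: KA_le_plusl. Qed.

Lemma test_minterm_le a p : sat a p -> test (minterm a) <== test p.
Proof.
move=> ap; have /= := minterm_and a p; rewrite ap => mp.
by rewrite -{1}mp test_and_le test_le1 KA_1dot.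
Qed.

Lemma test_minterm_dup a : test (minterm a) <== test (minterm a) * test (minterm a).
Proof. by rewrite -{1}(BAnd_idem (minterm a)); exact: test_and_le. Qed.

(** Shannon expansion on one variable at a time, [p] accumulating the literals chosen. As [s] has no
    repetition, setting or removing [x] in [a] leaves the minterm over the remaining variables
    unchanged. *)
Lemma test_le_minterms_on p s e : uniq s ->
  (forall a, test (BAnd p (minterm_on a s)) <== e) -> test p <== e.
Proof.
elim: s p => [|x s IHs] p /=; first by move=> _ /(_ finset.set0); rewrite BAnd_top.
move=> /andP[xs us] le_e; rewrite -(BAnd_top p) -(BOr_neg (BVar x)) BAndDr test_or.
apply: KA_plus_le; apply: IHs => // a.
- have := le_e (x |: a); rewrite /literal setU11 BAndA.
  suff -> : minterm_on (x |: a) s = minterm_on a s by [].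
  elim: s xs {us le_e} => //= y s IHs; rewrite inE negb_or => /andP[xy /IHs->].
  by rewrite /literal !inE eq_sym (negPf xy).
- have := le_e (a :\ x); rewrite /literal setD11 BAndA.
  suff -> : minterm_on (a :\ x) s = minterm_on a s by [].
  elim: s xs {us le_e} => //= y s IHs; rewrite inE negb_or => /andP[xy /IHs->].
  by rewrite /literal !inE eq_sym xy.
Qed.

Lemma test_le_minterms p :
  test p <== \big[@RPlus letter/0]_(a | sat a p) test (minterm a).
Proof.
apply: (test_le_minterms_on (enum_uniq Omega)) => a; rewrite -/(minterm a).
rewrite BAndC minterm_and; case: ifP => ap; last by rewrite test_bot; exact: KA_le0.
exact: (KA_le_bigplus Hk (fun a => test (minterm a))).
Qed.

Local Notation atomic := (Sigma + {set Omega})%type.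

Definition atomic_regexp (b : atomic) : regexp letter :=
  match b with inl x => RLetter (inl x) | inr a => test (minterm a) end.

Definition atomic_block (b : atomic) : set (seq letter) :=
  match b with
  | inl x => [set [:: inl x]]%classic
  | inr a => [set [seq inr p | p <- ps] | ps in [set ps | all (sat a) ps]]%classic
  end.

(** [a <= 1] covers the empty sequence of tests; otherwise [a <= a a] gives one copy for the first
    test and one for the rest. *)
Lemma atomic_le_block b s : atomic_block b s -> atomic_regexp b <== word_regexp s.
Proof.
case: b => [x|a] /=; first by move=> -> /=; rewrite KA_dot1.
move=> [ps + <-]; elim: ps => [|p ps IHps] /=; first by move=> _; exact: test_le1.
move=> /andP[ap /IHps le_ps]; rewrite test_minterm_dup {2}le_ps.
by rewrite (test_minterm_le ap).
Qed.

(** * Words of atoms and the closure under the hypotheses *)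

Local Notation match_lang L v := (exists2 u, L u & blocks atomic_block v u).

Lemma blocks_cat (v1 v2 : seq atomic) u :
  blocks atomic_block (v1 ++ v2) u <->
  lang_cat (blocks atomic_block v1) (blocks atomic_block v2) u.
Proof.
elim: v1 u => [|b v1 IHv1] u /=.
  by split=> [uv|[? [w [-> h ->]]] //]; exists [::], u.
split=> [[s [w [bs /IHv1[u1 [u2 [h1 h2 ->]]] ->]]]|].
  by exists (s ++ u1), u2; rewrite catA; split=> //; exists s, u1.
move=> [w [u2 [[s [u1 [bs h1 ->]]] h2 ->]]].
by exists s, (u1 ++ u2); rewrite catA; split=> //; apply/IHv1; exists u1, u2.
Qed.

(** Two adjacent sequences of tests above [a] concatenate to a single one. *)
Lemma blocks_contract v1 v2 a u :
  blocks atomic_block (v1 ++ inr a :: inr a :: v2) u ->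
  blocks atomic_block (v1 ++ inr a :: v2) u.
Proof.
move=> /blocks_cat[u1 [u2 [h1 h2 ->]]]; apply/blocks_cat; exists u1, u2; split=> //.
move: h2 => [? [? [[ps aps <-] [? [w [[qs aqs <-] h ->]]] ->]]].
exists [seq inr p | p <- ps ++ qs], w; split=> //; last by rewrite map_cat catA.
by exists (ps ++ qs) => //=; rewrite all_cat aps.
Qed.

(* [refines w v]: [v] arises from [w] by replacing each test by one of its atoms
   and inserting atoms anywhere. *)
Inductive refines : seq letter -> seq atomic -> Prop :=
| refines_nil : refines [::] [::]
| refines_letter x w v : refines w v -> refines (inl x :: w) (inl x :: v)
| refines_test p a w v : sat a p -> refines w v -> refines (inr p :: w) (inr a :: v)
| refines_insert a w v : refines w v -> refines w (inr a :: v).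

Lemma refines_cat w1 w2 v1 v2 :
  refines w1 v1 -> refines w2 v2 -> refines (w1 ++ w2) (v1 ++ v2).
Proof.
by elim=> //= *; [apply: refines_letter|apply: refines_test|apply: refines_insert];
  auto.
Qed.

Lemma refines_split w1 w2 v : refines (w1 ++ w2) v ->
  exists v1 v2, [/\ refines w1 v1, refines w2 v2 & v = v1 ++ v2].
Proof.
move wE : (w1 ++ w2) => w wv.
elim: wv w1 wE => {w v} [|x w v wv IH|p a w v ap wv IH|a w v wv IH] w1 wE.
- exists [::], [::]; move: wE; case: w1 => //= ->; split=> //; exact: refines_nil.
- case: w1 wE => /= [->|_ w1 [-> /IH[v1 [v2 [h1 h2 ->]]]]].
    by exists [::], (inl x :: v); split; [exact: refines_nil|exact: refines_letter|].
  by exists (inl x :: v1), v2; split=> //; exact: refines_letter.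
- case: w1 wE => /= [->|_ w1 [-> /IH[v1 [v2 [h1 h2 ->]]]]].
    by exists [::], (inr a :: v); split; [exact: refines_nil|exact: refines_test|].
  by exists (inr a :: v1), v2; split=> //; exact: refines_test.
- move: wE => /IH[v1 [v2 [h1 h2 ->]]].
  by exists (inr a :: v1), v2; split=> //; exact: refines_insert.
Qed.

Lemma refines_test_inv p v : refines [:: inr p] v ->
  exists v1 a v2, [/\ sat a p, refines [::] v1, refines [::] v2
                    & v = v1 ++ inr a :: v2].
Proof.
move wE : [:: inr p] => w wv.
elim: wv wE => {w v} // [q a w v aq wv _ [pq w0]|a w v wv IH /IH].
  by move: wv; rewrite -w0 pq => wv; exists [::], a, v; split=> //; exact: refines_nil.
move=> [v1 [b [v2 [bp h1 h2 ->]]]]; exists (inr a :: v1), b, v2; split=> //.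
exact: refines_insert.
Qed.

(** A replaced test is a block of length one, an inserted atom an empty block. *)
Lemma refines_blocks w v : refines w v -> blocks atomic_block v w.
Proof.
elim=> {w v} //= [x w v _ IH|p a w v ap _ IH|a w v _ IH].
- by exists [:: inl x], w.
- by exists [:: inr p], w; split=> //; exists [:: p] => //=; rewrite ap.
- by exists [::], w; split=> //; exists [::].
Qed.

(* [padded b v]: every letter of [Sigma] in [v] has an atom on both sides and [v]
   ends with an atom, where [b] tells whether an atom precedes [v]. *)
Fixpoint padded (b : bool) (v : seq atomic) : bool :=
  match v with
  | [::] => b
  | inl _ :: v' => b && padded false v'
  | inr _ :: v' => padded true v'
  end.

Lemma padded_cat b v1 v2 : padded b v1 -> padded true v2 -> padded b (v1 ++ v2).
Proof.
elim: v1 b => [|[x|a] v1 IH] b /=; first by move=> ->.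
  by move=> /andP[-> /IH]; apply.
exact: IH.
Qed.

Lemma padded_dup b v1 a v2 :
  padded b (v1 ++ inr a :: inr a :: v2) = padded b (v1 ++ inr a :: v2).
Proof. by elim: v1 b => [|[x|c] v1 IH] b //=; rewrite IH. Qed.

(** Provides the atom next to a cut that the hypothesis [1 <= BTop] calls for. *)
Lemma padded_boundary v1 v2 : padded false (v1 ++ v2) ->
  (exists v a, v1 = rcons v (inr a)) \/ (exists a v, v2 = inr a :: v).
Proof.
(* In the induction the neighbouring atom may already have been read, which [b] records; for
   [b = false] this case is void. *)
suff gen b : padded b (v1 ++ v2) -> [\/ b /\ v1 = [::],
    exists v a, v1 = rcons v (inr a) | exists a v, v2 = inr a :: v].
  by case/gen; [case|left|right].
elim: v1 b => [|[x|a] v1 IH] b /=.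
- case: v2 => [|[x|a] v2] /=; first by constructor 1.
    by case/andP; constructor 1.
  by constructor 3; exists a, v2.
- case/andP=> _ /IH[[//]|[v [a ->]]|h]; last by constructor 3.
  by constructor 2; exists (inl x :: v), a.
- case/IH=> [[_ ->]|[v [c ->]]|h]; last by constructor 3.
    by constructor 2; exists [::], a.
  by constructor 2; exists (inr a :: v), c.
Qed.

(* Only padded words are tested, because of the hypothesis [1 <= BTop], that is, the
   rule deriving [u v] from all the [u a v]: next to an atom it is an instance of
   contraction. *)
Definition refined_closure (L : set (seq letter)) : set (seq letter) :=
  [set w | forall v, padded false v -> refines w v -> match_lang L v]%classic.

(** For hypotheses where one refinement [t] serves both sides: the refined word is cut at the
    context and reassembled. Only [BAnd p q <= p q] and [1 <= BTop] also need contraction. *)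
Lemma refined_closure_transfer L (e f : regexp letter) :
  (forall w t, lang e w -> refines w t -> exists2 w', lang f w' & refines w' t) ->
  forall u v,
    ([set u ++ w ++ v | w in lang f] `<=` refined_closure L)%classic ->
    ([set u ++ w ++ v | w in lang e] `<=` refined_closure L)%classic.
Proof.
move=> ef u v fL _ [w ew <-] t pt.
move=> /refines_split[t1 [_ [r1 /refines_split[t2 [t3 [r2 r3 ->]]] tE]]].
have [w' fw' r2'] := ef _ _ ew r2.
apply: (fL (u ++ w' ++ v)) => //; first by exists w'.
by rewrite tE; do 2!apply: refines_cat => //.
Qed.

Lemma refined_closure_contract L v1 a v2 :
  match_lang L (v1 ++ inr a :: inr a :: v2) -> match_lang L (v1 ++ inr a :: v2).
Proof. by case=> u Lu /blocks_contract; exists u. Qed.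

Lemma refined_closure_closed L : H_closed Hk (refined_closure L).
Proof.
have test_sat p q : (forall a, sat a p -> sat a q) -> forall t,
    refines [:: inr p] t -> refines [:: inr q] t.
  move=> pq t /refines_test_inv[v1 [a [v2 [/pq aq r1 r2 ->]]]].
  by rewrite -[[:: inr q]]cat0s; apply: refines_cat => //; exact: refines_test.
move=> e f [[[[]|]|]|].
- move=> [p [q [pq [] [-> ->]]]]; apply: refined_closure_transfer => w t /= -> rt;
    eexists; rewrite //; apply: test_sat rt => a; by rewrite (ba_instance_sat a pq).
- move=> [p [q [-> ->]]] u v fL _ [w /= -> <-] t pt.
  move=> /refines_split[t1 [_ [r1 /refines_split[t2 [t3 [r2 r3 ->]]] tE]]].
  have [v1 [a [v2 [/= /andP[ap aq] s1 s2 t2E]]]] := refines_test_inv r2.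
  move: pt; rewrite {}tE {}t2E {t t2 r2}.
  rewrite (_ : t1 ++ _ = (t1 ++ v1) ++ inr a :: (v2 ++ t3)); last by rewrite -!catA.
  (* The atom refining [BAnd p q] is doubled, one copy refining [p] and the other [q], and then
     contracted. *)
  rewrite -padded_dup => pt; apply: refined_closure_contract.
  apply: (fL (u ++ [:: inr p; inr q] ++ v)) => //.
    by exists [:: inr p; inr q] => //; exists [:: inr p], [:: inr q].
  rewrite -catA; apply: refines_cat => //.
  rewrite -[_ ++ v]cat0s; apply: refines_cat => //.
  do 2!apply: refines_test => //; rewrite -[v]cat0s; exact: refines_cat.
- move=> [p [q [] [-> ->]]]; apply: refined_closure_transfer => w t /=.
    move=> -> /refines_test_inv[v1 [a [v2 [/= /orP apq r1 r2 ->]]]].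
    have [r|r] : refines [:: inr p] (v1 ++ inr a :: v2) \/
                refines [:: inr q] (v1 ++ inr a :: v2).
      by case: apq => h; [left|right]; rewrite -[[:: _]]cat0s;
        apply: refines_cat => //; exact: refines_test.
    + by exists [:: inr p] => //; left.
    + by exists [:: inr q] => //; right.
  by case=> -> rt; exists [:: inr (BOr p q)] => //; apply: test_sat rt => a /= ->;
    rewrite ?orbT.
- case=> -[-> ->]; apply: refined_closure_transfer => w t //=.
  by move=> -> /refines_test_inv[? [? [? []]]].
- case=> -[-> ->].
    apply: refined_closure_transfer => w t /= -> /refines_test_inv.
    move=> [v1 [a [v2 [_ r1 r2 ->]]]]; exists [::] => //.
    by rewrite -[[::]]cats0; apply: refines_cat => //; exact: refines_insert.
  move=> u v fL _ [w /= -> <-] t pt; rewrite cat0s.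
  move=> /refines_split[t1 [t2 [r1 r2 tE]]]; move: pt; rewrite {}tE {t}.
  have ctx : ([set u ++ [:: inr BTop] ++ v] `<=` refined_closure L)%classic.
    by move=> _ ->; apply: fL; exists [:: inr BTop].
  (* The atom beside the cut between [u] and [v] is doubled, and the copy at the cut refines
     [BTop]. *)
  move=> pt; case: (padded_boundary pt) => [[s1 [a t1E]]|[a [s2 t2E]]].
    move: pt r1; rewrite {}t1E cat_rcons -padded_dup => pt r1.
    apply: refined_closure_contract; apply: (ctx _ erefl) => //.
    by rewrite -cat_rcons; apply: refines_cat => //; exact: refines_test.
  move: pt r2; rewrite {}t2E -padded_dup => pt r2.
  apply: refined_closure_contract; apply: (ctx _ erefl) => //.
  by apply: refines_cat => //; exact: refines_test.
Qed.

Lemma subset_refined_closure L : (L `<=` refined_closure L)%classic.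
Proof. by move=> w Lw v _ /refines_blocks wv; exists w. Qed.

Lemma H_closure_match L v w : padded false v -> refines w v ->
  H_closure Hk L w -> match_lang L v.
Proof.
move=> pv rv clw; apply: (clw (refined_closure L)) rv => //.
by split; [exact: refined_closure_closed | exact: subset_refined_closure].
Qed.

(** * Padded expressions and completeness *)

Definition any_atom : regexp atomic :=
  \big[@RPlus atomic/0]_(a : {set Omega}) RLetter (inr a).

Fixpoint refine_regexp (e : regexp letter) : regexp atomic :=
  match e with
  | RZero => 0
  | ROne => 1
  | RLetter (inl x) => any_atom * (RLetter (inl x) * any_atom)
  | RLetter (inr p) => \big[@RPlus atomic/0]_(a | sat a p) RLetter (inr a)
  | RPlus e1 e2 => refine_regexp e1 + refine_regexp e2
  | RDot e1 e2 => refine_regexp e1 * refine_regexp e2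
  | RStar e1 => (refine_regexp e1)^*
  end.

(** The empty word, for one, is padded only after an atom, which the outer [any_atom] supplies. *)
Definition pad_regexp (e : regexp letter) : regexp atomic :=
  any_atom * (refine_regexp e * any_atom).

Lemma rsubst_bigplus (P : pred {set Omega}) (F : {set Omega} -> regexp atomic) :
  rsubst atomic_regexp (\big[@RPlus atomic/0]_(a | P a) F a)
  = \big[@RPlus letter/0]_(a | P a) rsubst atomic_regexp (F a).
Proof. exact: (big_morph (rsubst atomic_regexp)). Qed.

Lemma lang_bigplus (P : pred {set Omega}) (F : {set Omega} -> regexp atomic) v :
  lang (\big[@RPlus atomic/0]_(a | P a) F a) v -> exists2 a, P a & lang (F a) v.
Proof.
apply: (big_ind (fun e => lang e v -> exists2 a, P a & lang (F a) v)) => //.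
  by move=> e1 e2 IH1 IH2 [/IH1|/IH2].
by move=> a Pa av; exists a.
Qed.

Lemma any_atom_ge1 : 1 <== rsubst atomic_regexp any_atom.
Proof.
rewrite -test_top test_le_minterms /any_atom rsubst_bigplus.
apply: KA_bigplus_le => a _.
exact: (KA_le_bigplus Hk (fun a => test (minterm a))).
Qed.

Lemma refine_regexp_ge e : e <== rsubst atomic_regexp (refine_regexp e).
Proof.
elim: e => [||[x|p]|e1 IH1 e2 IH2|e1 IH1 e2 IH2|e IH] //=.
- by rewrite -any_atom_ge1 KA_1dot KA_dot1.
- by rewrite rsubst_bigplus; exact: test_le_minterms.
- by rewrite {1}IH1 {1}IH2.
- by rewrite {1}IH1 {1}IH2.
- by rewrite {1}IH.
Qed.

Lemma pad_regexp_ge e : e <== rsubst atomic_regexp (pad_regexp e).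
Proof. by rewrite /= -any_atom_ge1 KA_1dot KA_dot1; exact: refine_regexp_ge. Qed.

Lemma lang_any_atom v : lang any_atom v -> exists a, v = [:: inr a].
Proof. by move=> /lang_bigplus[a _ /= ->]; exists a. Qed.

(** [padded true] is the invariant because it holds of the empty word and is preserved by
    concatenation. *)
Lemma lang_refine_regexp e v : lang (refine_regexp e) v ->
  padded true v /\ exists2 w, lang e w & refines w v.
Proof.
elim: e v => [||[x|p]|e1 IH1 e2 IH2|e1 IH1 e2 IH2|e IH] v //=.
- by move=> ->; split=> //; exists [::] => //; exact: refines_nil.
- move=> [_ [_ [/lang_any_atom[a ->] [_ [_ [-> /lang_any_atom[b ->] ->]]] ->]]].
  split=> //; exists [:: inl x] => //=.
  by apply/refines_insert/refines_letter/refines_insert/refines_nil.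
- move=> /lang_bigplus[a ap /= ->]; split=> //; exists [:: inr p] => //.
  by apply: refines_test => //; exact: refines_nil.
- by case=> [/IH1|/IH2] [pv [w ew wv]]; split=> //; exists w => //; [left|right].
- move=> [v1 [v2 [/IH1[p1 [w1 h1 r1]] /IH2[p2 [w2 h2 r2]] ->]]].
  split; first exact: padded_cat.
  by exists (w1 ++ w2); [exists w1, w2 | exact: refines_cat].
- elim/lang_star_ind => [|v1 v2 /IH[p1 [w1 h1 r1]] [p2 [w2 h2 r2]]].
    by split=> //; exists [::]; [exact: lang_star_nil | exact: refines_nil].
  split; first exact: padded_cat.
  by exists (w1 ++ w2); [exact: lang_star_cat | exact: refines_cat].
Qed.

Lemma lang_pad_regexp e v : lang (pad_regexp e) v ->
  padded false v /\ exists2 w, lang e w & refines w v.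
Proof.
move=> [_ [_ [/lang_any_atom[a ->] [v' [_ [ev' /lang_any_atom[b ->] ->]]] ->]]].
have [pv' [w ew wv']] := lang_refine_regexp ev'; split.
  exact: (@padded_cat true v' [:: inr b]).
exists w => //; apply: refines_insert; rewrite -[w]cats0; apply: refines_cat => //.
by apply/refines_insert/refines_nil.
Qed.

(** A word of [pad_regexp e] is padded and refines a word of [e]; that word lies in the closure of
    [lang f], so the padded word matches a word of [f]. *)
Lemma KA_le_of_H_closure (e f : regexp letter) :
  (lang e `<=` H_closure Hk (lang f))%classic -> e <== f.
Proof.
move=> ef; rewrite (pad_regexp_ge e).
apply: (rsubst_le_of_blocks atomic_le_block) => v /lang_pad_regexp.
by move=> [pv [w /ef clw wv]]; exact: H_closure_match clw.
Qed.

End Tests.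

Theorem theorem6p7 (Sigma Omega : finType)
    (e f : regexp (Sigma + bexp Omega)) :
  H_closure (hyp_kabo Sigma Omega) (lang e) =
    H_closure (hyp_kabo Sigma Omega) (lang f) ->
  KA_derivable (hyp_kabo Sigma Omega) e f.
Proof.
move=> ef; apply: KA_le_antisym; apply: KA_le_of_H_closure.
  by rewrite -ef; exact: sub_gen_smallest.
by rewrite ef; exact: sub_gen_smallest.
Qed.
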